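(* Let $q$ be an odd prime power, $t\ge 3$ an integer, $s$ a positive integer with $\gcd(s,t)=1$. Let $E=\{x\in\mathbb{F}_{q^{2t}}\colon \mathrm{Tr}_{q^{2t}/q^t}(x)=0\}$, let $w\in E$, $w\neq 0$, be such that $\mathrm{N}_{q^t/q}(w^2)\neq(-1)^t$, and let $I$ be an $i$-dimensional $\mathbb{F}_q$-subspace of $\mathbb{F}_{q^t}$, $i\ge 2$. Define $$T=T_{s,w,I}=\{x+wx^{q^s}\colon x\in I\}\subseteq\mathbb{F}_{q^{2t}}.$$ Then for any integer $k>1$, $L_{T^k}$ is a $\left(\frac{q^k-1}{q-1},i\right)$-regular fat linear set of rank $ki$ in $\mathrm{PG}(k-1,q^{2t})$. The points of weight $i$ are precisely the elements of $\mathrm{PG}(k-1,q)$, i.e. the points $(a_1:a_2:\ldots:a_k)$ with $(0,0,\ldots,0)\neq(a_1,a_2,\ldots,a_k)\in\mathbb{F}_q^k$.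
   Context: Trace and norm: $\mathrm{Tr}_{q^{2t}/q^t}(x)=x^{q^t}+x$ for $x\in\mathbb{F}_{q^{2t}}$, and $\mathrm{N}_{q^t/q}(x)=x^{(q^t-1)/(q-1)}$ for $x\in\mathbb{F}_{q^t}$ (note $w^2\in\mathbb{F}_{q^t}$ for $w\in E$). $T^k=T\times\cdots\times T\subseteq\mathbb{F}_{q^{2t}}^k$. For an $\mathbb{F}_q$-subspace $U$ of $\mathbb{F}_{q^n}^k$ with $\dim_{\mathbb{F}_q}U=\rho$, the linear set of rank $\rho$ in $\mathrm{PG}(k-1,q^n)$ associated with $U$ is $L_U=\{\langle v\rangle_{\mathbb{F}_{q^n}}\colon v\in U,\ v\ne0\}$. The weight of a point $P=\langle v\rangle_{\mathbb{F}_{q^n}}$ is $w_{L_U}(P)=\dim_{\mathbb{F}_q}(\langle v\rangle_{\mathbb{F}_{q^n}}\cap U)$. The point $\langle(\alpha_1,\ldots,\alpha_k)\rangle_{\mathbb{F}_{q^n}}$ is denoted $(\alpha_1:\ldots:\alpha_k)$. For integers $r\ge0$, $i\ge2$, the linear set $L_U$ is $(r,i)$-regular fat if it has exactly $r$ points of weight $i$, all its remaining points have weight one, and there is at least one point of weight one. Here $n=2t$. *)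

(* Defs.v *)
From HB Require Import structures.
From mathcomp Require Import all_boot all_order all_algebra all_field.

Set Implicit Arguments.
Unset Strict Implicit.
Unset Printing Implicit Defensive.

Import GRing.Theory.

Local Open Scope ring_scope.

Definition has_card (X : eqType) (A : X -> Prop) (r : nat) : Prop :=
  exists s : seq X, [/\ uniq s, size s = r & forall x, x \in s <-> A x].

Section LinearSets.

Variables (F : fieldType) (L : fieldExtType F) (k : nat).

(* L^k, regarded as a vector space over F. *)
Local Notation V := {ffun 'I_k -> L}.

Definition scale_vec (v : V) (a : L) : V := [ffun j => a * v j].

Fact scale_vec_linear v : linear (scale_vec v).
Proof.
by move=> c a b; apply/ffunP => j; rewrite !ffunE mulrDl scalerAl.
Qed.

HB.instance Definition _ v :=
  GRing.isLinear.Build F L V _ (scale_vec v) (scale_vec_linear v).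

(* The L-span <v>_L, as an F-subspace of L^k (see [memv_point]). *)
Definition point (v : V) : {vspace V} := limg (linfun (scale_vec v)).

Lemma memv_point (v u : V) :
  reflect (exists a : L, u = [ffun j => a * v j]) (u \in point v).
Proof.
apply: (iffP memv_imgP) => [[a _ ->]|[a ->]]; exists a => //.
- by rewrite lfunE.
- exact: memvf.
- by rewrite lfunE.
Qed.

(* The points of PG(k-1, L): the subsets <v>_L of L^k with v nonzero. *)
Definition is_point (P : {vspace V}) : Prop :=
  exists v : V, v != 0 /\ P = point v.

(* The points (a_1 : ... : a_k) with a nonzero vector a in F^k. *)
Definition is_rational_point (P : {vspace V}) : Prop :=
  exists a : {ffun 'I_k -> F}, a != 0 /\ P = point [ffun j => (a j)%:A].

Definition linear_set (U P : {vspace V}) : Prop :=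
  exists v : V, [/\ v \in U, v != 0 & P = point v].

Definition weight (U P : {vspace V}) : nat := \dim (P :&: U).

Definition regular_fat (r i : nat) (U : {vspace V}) : Prop :=
  [/\ has_card (fun P => linear_set U P /\ weight U P = i) r,
      forall P, linear_set U P -> weight U P <> i -> weight U P = 1%N
    & exists P, linear_set U P /\ weight U P = 1%N].

Definition coord_fun (j : 'I_k) (v : V) : L := v j.

Fact coord_fun_linear j : linear (coord_fun j).
Proof. by move=> c u v; rewrite /coord_fun !ffunE. Qed.

HB.instance Definition _ j :=
  GRing.isLinear.Build F V L _ (coord_fun j) (coord_fun_linear j).

(* T x ... x T in L^k (see [memv_power]). *)
Definition power (T : {vspace L}) : {vspace V} :=
  (\bigcap_(j < k) (linfun (coord_fun j) @^-1: T))%VS.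

Lemma memv_power (T : {vspace L}) (v : V) :
  reflect (forall j, v j \in T) (v \in power T).
Proof.
rewrite memvE; apply: (iffP subv_bigcapP) => vT j => [|_].
  by have := vT j isT; rewrite -memvE -memv_preim lfunE.
by rewrite -memvE -memv_preim lfunE; apply: vT.
Qed.

End LinearSets.

Arguments power {F L} k T.

(* Over F = F_q, with q = #|F|: the trace of F_{q^2t} over F_{q^t}, and the
   norm of F_{q^t} over F_q. *)
Section TraceNorm.

Variables (F : finFieldType) (L : fieldExtType F) (t : nat).

Definition trace_q2t_qt (x : L) : L := x ^+ (#|F| ^ t) + x.

Definition norm_qt_q (x : L) : L := x ^+ ((#|F| ^ t - 1) %/ (#|F| - 1)).

End TraceNorm.

Section SpaceT.

Variables (F : finFieldType) (L : fieldExtType F) (s : nat) (w : L).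

Definition twist (x : L) : L := x + w * x ^+ (#|F| ^ s).

Fact twist_linear : linear twist.
Proof.
have [p _ pF] := finPcharP F.
have pL : p \in [pchar L] by rewrite pchar_lalg.
have qp : [pchar L].-nat (#|F| ^ s)%N.
  rewrite (eq_pnat _ (pcharf_eq pL)) pnatX; apply/orP; left.
  by rewrite -cardsT; apply: (pprimeChar_pgroup pF).
have Fs (c : F) : c ^+ (#|F| ^ s) = c.
  by elim: s => [|m IHm]; rewrite ?expr1 // expnSr exprM IHm expf_card.
move=> c x y; rewrite /twist exprDn_pchar // exprZn Fs.
by rewrite mulrDr scalerDr -scalerAr addrACA.
Qed.

HB.instance Definition _ :=
  GRing.isLinear.Build F L L _ twist twist_linear.

Definition spaceT (I : {vspace L}) : {vspace L} := (linfun twist @: I)%VS.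

Lemma memv_spaceT (I : {vspace L}) (y : L) :
  reflect (exists2 x, x \in I & y = x + w * x ^+ (#|F| ^ s)) (y \in spaceT I).
Proof.
by apply: (iffP memv_imgP) => -[x xI ->]; exists x; rewrite ?lfunE.
Qed.

End SpaceT.

(* Main.v *)
Require Import Defs.
From HB Require Import structures.
From mathcomp Require Import all_boot all_order all_algebra all_field.
From mathcomp Require Import ring.
Import GRing.Theory.
Local Open Scope ring_scope.

(** Everything about [L_{T^k}] follows from one multiplicative property of [T],
    that of a Sidon space ([sidon_space]): if [u v' = u' v] with all four
    elements in [T] and [u], [u'] nonzero, then [v] or [u'] is an
    [F]-multiple of [u].

    Sidon spaces give regular fat linear sets ([regular_fat_sidon]).  The weight
    of [<v>_L] is the [F]-dimension of the space of the scalars [a] such that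
    [a v] lies in [T^k].  If it is at least 2, choose two [F]-independent
    scalars [a] and [b] in that space.  For coordinates [j] and [l] the products
    [(a v_j) (b v_l) = (a v_l) (b v_j)] agree, and the Sidon property, the first
    alternative being excluded by the independence of [a] and [b], forces [v_l]
    to be an [F]-multiple of [v_j].  So [<v>_L] has coordinates in [F]
    ([weight_sidon]).  Conversely [a] times a nonzero vector over [F] lies in
    [T^k] exactly when [a] lies in [T], so such a point has weight [dim T]
    ([weight_rational]).

    The space [T = {x + w x^(q^s) : x in I}] is a Sidon space ([sidon_spaceT]).
    Write [Q = q^s].  In odd characteristic [w] lies outside [K], but [w^2] lies
    in [K], so [1, w] is a basis of [L] over [K].  Comparing coordinates in the
    equation [u v' = u' v], where [u, u', v, v'] come from [x, x', y, y'], gives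
    [z + w^2 z^Q = 0] for [z = x y' - x' y], together with
    [x y'^Q + x^Q y' = x' y^Q + x'^Q y].  A nonzero [z] would have
    [N(z) = N(-w^2) N(z) = (-1)^t N(w^2) N(z)], against the hypothesis on
    [N(w^2)]; so [x y' = x' y] ([twist_eq0]).  Then the two summands on either
    side of the second equation have the same sum and the same product, hence
    they agree up to order, and either matching makes a ratio [x'/x] or [y/x]
    fixed by [Q]-th powers.  As [s] and [t] are coprime, a fixed element of [K]
    lies in [F]. *)

(** Sidon spaces are usually defined by the equality of the sets of lines
    [{<u>, <v'>}] and [{<u'>, <v>}] whenever [u v' = u' v] with nonzero factors;
    given [u v' = u' v], two memberships suffice to say so, and this form allows
    [v] and [v'] to be zero. *)
Definition sidon_space (F : fieldType) (L : fieldExtType F) (T : {vspace L}) :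
    Prop :=
  forall u u' v v', u \in T -> u' \in T -> v \in T -> v' \in T ->
  u != 0 -> u' != 0 -> u * v' = u' * v -> v \in <[u]>%VS \/ u' \in <[u]>%VS.

Arguments sidon_space {F L} T.

(** * Powers of Frobenius, and the norm *)

Section FrobeniusPowers.

Variables (F : finFieldType) (L : fieldExtType F).
Local Notation q := #|F|.

Lemma expr_card_iter (m n : nat) (x : L) :
  x ^+ (q ^ m) = x -> x ^+ (q ^ (m * n)) = x.
Proof.
move=> xm; elim: n => [|n IHn]; first by rewrite muln0 expn0 expr1.
by rewrite mulnS expnD exprM xm.
Qed.

Lemma expr_card_subfield (K : {subfield L}) (x : L) :
  (x \in K) = (x ^+ (q ^ \dim K) == x).
Proof. exact: Fermat's_little_theorem. Qed.

Lemma mem1v_expr_card (x : L) : (x \in 1%VS) = (x ^+ q == x).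
Proof. by rewrite (Fermat's_little_theorem 1%AS) dimv1 expn1. Qed.

(** By a Bezout relation [s u = t v + 1], the [(s u)]-th iterate of Frobenius,
    which fixes [x], is Frobenius itself composed with iterates of the [t]-th
    one. *)
Lemma expr_card_coprime_fixed (s t : nat) (x : L) :
    (0 < s)%N -> coprime s t ->
  x ^+ (q ^ s) = x -> x ^+ (q ^ t) = x -> x \in 1%VS.
Proof.
move=> s_gt0 /eqP cst xs xt; rewrite mem1v_expr_card.
case: (egcdnP t s_gt0) => u v uv _; apply/eqP.
have := expr_card_iter _ u _ xs; rewrite mulnC uv cst addn1 expnSr exprM.
by rewrite mulnC expr_card_iter.
Qed.

Lemma expr0_card m : 0 ^+ (q ^ m) = 0 :> L.
Proof. by rewrite expr0n expn_eq0 -leqn0 leqNgt (ltnW (finNzRing_gt1 F)). Qed.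

(** The norm of an element of [K] lies in [F], so Frobenius fixes it. *)
Lemma norm_qt_q_expr_card (K : {subfield L}) (m : nat) (z : L) :
  z \in K -> norm_qt_q (\dim K) (z ^+ (q ^ m)) = norm_qt_q (\dim K) z.
Proof.
move=> zK; rewrite /norm_qt_q.
have [->|z0] := eqVneq z 0; first by rewrite expr0_card.
set e := (_ %/ _)%N; have e_def : (q ^ \dim K - 1)%N = (e * (q - 1))%N.
  by rewrite divnK // !subn1 predn_exp dvdn_mulr.
have ze : (z ^+ e) ^+ q = z ^+ e.
  rewrite -[X in _ ^+ X](subnK (ltnW (finNzRing_gt1 F))) exprD expr1.
  rewrite -exprM -e_def.
  (* Multiplying by [z] turns [z^(q^t - 1)] into [z^(q^t)], where [t = dim K]. *)
  apply: (mulfI z0); rewrite mulrA -exprS.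
  rewrite subn1 prednK ?expn_gt0 ?(ltnW (finNzRing_gt1 F)) //.
  by move: zK; rewrite expr_card_subfield => /eqP->.
by rewrite exprAC -[m]mul1n expr_card_iter ?expn1.
Qed.

(** The exponent is [1 + q + ... + q^(t-1)], a sum of [t] odd numbers. *)
Lemma odd_norm_exponent (t : nat) :
  odd q -> odd ((q ^ t - 1) %/ (q - 1)) = odd t.
Proof.
move=> q_odd; have q1 : (0 < q.-1)%N.
  by rewrite -ltnS prednK ?finNzRing_gt1 // ltnW ?finNzRing_gt1.
rewrite !subn1 predn_exp mulKn //.
elim: t => [|t IHt]; first by rewrite big_ord0.
by rewrite big_ord_recr /= oddD IHt oddX q_odd orbT addbT.
Qed.

Lemma norm_qt_qN (t : nat) (z : L) :
  odd q -> norm_qt_q t (- z) = (-1) ^+ t * norm_qt_q t z.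
Proof.
move=> q_odd; rewrite /norm_qt_q [LHS]exprNn.
by rewrite -[in LHS]signr_odd odd_norm_exponent // signr_odd.
Qed.

(** A nonzero [z] with [z = - c z^(q^s)] would satisfy
    [N(z) = (-1)^t N(c) N(z)] with [t = dim K], since [N(z^(q^s)) = N(z)]. *)
Lemma twist_eq0 (K : {subfield L}) (s : nat) (c z : L) :
    odd q -> norm_qt_q (\dim K) c != (-1) ^+ \dim K ->
  z \in K -> twist s c z = 0 -> z = 0.
Proof.
move=> q_odd cN zK; rewrite /twist => /eqP; rewrite addr_eq0 => /eqP z_eq.
apply: contraNeq cN => z0.
have Nz0 : norm_qt_q (\dim K) z != 0 by rewrite expf_neq0.
have : norm_qt_q (\dim K) z
    = (-1) ^+ \dim K * norm_qt_q (\dim K) c * norm_qt_q (\dim K) z.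
  rewrite {1}z_eq norm_qt_qN // -mulrA; congr (_ * _).
  by rewrite -(norm_qt_q_expr_card K s z zK) /norm_qt_q exprMn.
rewrite -{1}[norm_qt_q _ z]mul1r => /(mulIf Nz0) N1.
move: N1 (sqrr_sign L (\dim K)); set sg := (-1) ^+ _ => N1 sg2.
by apply/eqP; rewrite -[RHS]mulr1 N1 mulrA -expr2 sg2 mul1r.
Qed.

Lemma memv_twist (K : {subfield L}) s c z :
  c \in K -> z \in K -> twist s c z \in K.
Proof. by move=> cK zK; rewrite /twist rpredD ?rpredM ?rpredX. Qed.

(** * The coordinates over [K] given by [w] *)

Lemma natr2_neq0 : odd q -> 2%:R != 0 :> L.
Proof.
move=> q_odd; apply: contraTneq q_odd => L2.
have [p p_pr pF] := finPcharP F.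
have pL : p \in [pchar L] by rewrite pchar_lalg.
have p2 : p = 2.
  have : (2 : nat) \in [pchar L] by rewrite inE /= L2 eqxx.
  by rewrite (pcharf_eq pL) inE => /eqP.
have : p.-nat q by rewrite -cardsT; apply: (pprimeChar_pgroup pF).
move/part_pnat_id; rewrite p_part p2 => qE; rewrite -qE oddX orbF.
by apply: contraTneq (finNzRing_gt1 F) => l0; rewrite -qE l0.
Qed.

(** If [w] were in [K], the trace of [w] would be [2 w], which is nonzero in odd
    characteristic. *)
Lemma trace0_notin (K : {subfield L}) (w : L) :
  odd q -> trace_q2t_qt (\dim K) w = 0 -> w != 0 -> w \notin K.
Proof.
move=> q_odd; rewrite /trace_q2t_qt => wE w0; rewrite expr_card_subfield.
apply: contraNneq w0 => ww; move/eqP: wE.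
by rewrite ww -mulr2n -mulr_natl mulf_eq0 (negPf (natr2_neq0 q_odd)).
Qed.

Lemma trace0_sqr (K : {subfield L}) (w : L) :
  trace_q2t_qt (\dim K) w = 0 -> w ^+ 2 \in K.
Proof.
rewrite /trace_q2t_qt => /eqP; rewrite addr_eq0 => /eqP ww.
by rewrite expr_card_subfield exprAC ww sqrrN.
Qed.

Lemma quadratic_coord (K : {subfield L}) (w x y x' y' : L) :
    w \notin K -> x \in K -> y \in K -> x' \in K -> y' \in K ->
  x + w * y = x' + w * y' -> x = x' /\ y = y'.
Proof.
move=> wK xK yK x'K y'K eq_xy.
have yy : y = y'.
  apply: contraNeq wK; rewrite -subr_eq0 => d0.
  have -> : w = (x' - x) / (y - y').
    apply: (mulIf d0); rewrite mulfVK //.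
    transitivity (x + w * y - (x + w * y')); first by ring.
    by rewrite eq_xy; ring.
  by rewrite rpred_div ?rpredB.
by split=> //; move: eq_xy; rewrite yy => /addIr.
Qed.

(** [a] is a root of [(X - c) (X - d) = X^2 - (a + b) X + a b]. *)
Lemma sum_prod_eq (R : idomainType) (a b c d : R) :
  a + b = c + d -> a * b = c * d -> a = c \/ a = d.
Proof.
move=> sE pE; have /eqP : (a - c) * (a - d) = 0.
  have -> : (a - c) * (a - d) = a * a - a * (c + d) + c * d by ring.
  by rewrite -sE -pE; ring.
by rewrite mulf_eq0 !subr_eq0 => /orP[] /eqP->; [left|right].
Qed.

(** * The space of the elements [x + w x^(q^s)] is a Sidon space *)

Section SpaceT.

Variables (K : {subfield L}) (s : nat) (w : L).
Hypotheses (q_odd : odd q) (s_gt0 : (0 < s)%N) (hst : coprime s (\dim K)).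
Hypotheses (wE : trace_q2t_qt (\dim K) w = 0) (w_neq0 : w != 0).
Hypothesis wN : norm_qt_q (\dim K) (w ^+ 2) != (-1) ^+ \dim K.

Lemma lker_twist : (K :&: lker (linfun (twist s w)) = 0)%VS.
Proof.
apply/eqP; rewrite -subv0; apply/subvP=> x; rewrite memv_cap memv_ker lfunE.
case/andP=> xK /eqP x0; rewrite memv0; apply/eqP.
have wK := trace0_notin K w q_odd wE w_neq0.
have [] // := quadratic_coord K w x (x ^+ (q ^ s)) 0 0 wK.
  1-3: by rewrite ?rpredX ?rpred0.
by rewrite mulr0 addr0.
Qed.

Lemma dim_spaceT (I : {vspace L}) : (I <= K)%VS -> \dim (spaceT s w I) = \dim I.
Proof.
move=> IK; apply: limg_dim_eq; apply/eqP; rewrite -subv0 -lker_twist.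
by rewrite capvS.
Qed.

(** The hypothesis says that [y / x] is fixed by the [q^s]-th power map. *)
Lemma expr_card_ratio (x y : L) :
    x \in K -> y \in K -> x != 0 -> x ^+ (q ^ s) * y = y ^+ (q ^ s) * x ->
  exists c : F, y = c *: x.
Proof.
move=> xK yK x0 xy.
have /vlineP[c cE] : y / x \in 1%VS.
  apply: (expr_card_coprime_fixed s (\dim K)) => //; last first.
    by apply/eqP; rewrite -expr_card_subfield rpred_div.
  rewrite exprMn exprVn; apply/eqP; rewrite eqr_div ?expf_neq0 //.
  by rewrite -xy mulrC.
by exists c; rewrite -mulr_algl -cE divfK.
Qed.

(** The elements [x], [x'], [y], [y'] of [I] stand for [u], [u'], [v], [v'].  The
    coordinates over [K] of [u v' = u' v] give [x y' = x' y] by the norm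
    condition, and then the pairs [{x y'^Q, x^Q y'}] and [{x' y^Q, x'^Q y}], where
    [Q = q^s], have equal sum and product.  If [x y'^Q = x' y^Q], the ratio
    [x' / x] is in [F]; if [x y'^Q = x'^Q y], the ratio [y / x] is. *)
Lemma sidon_spaceT (I : {vspace L}) :
  (I <= K)%VS -> sidon_space (spaceT s w I).
Proof.
move=> /subvP IK u u' v v' /memv_spaceT[x /IK xK ->] /memv_spaceT[x' /IK x'K ->].
move=> /memv_spaceT[y /IK yK ->] /memv_spaceT[y' /IK y'K ->] u0 u'0 uv.
have nz z : z + w * z ^+ (q ^ s) != 0 -> z != 0.
  by apply: contraNneq => ->; rewrite expr0_card mulr0 addr0.
have [->|y0] := eqVneq y 0.
  by left; rewrite expr0_card mulr0 addr0 mem0v.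
have x0 := nz _ u0; have x'0 := nz _ u'0.
have w2K := trace0_sqr K w wE.
have wK := trace0_notin K w q_odd wE w_neq0.
have [] := quadratic_coord K w (twist s (w ^+ 2) (x * y'))
  (x * y' ^+ (q ^ s) + x ^+ (q ^ s) * y') (twist s (w ^+ 2) (x' * y))
  (x' * y ^+ (q ^ s) + x' ^+ (q ^ s) * y) wK.
1,3: by apply: memv_twist => //; rewrite rpredM.
1,2: by rewrite rpredD ?rpredM ?rpredX.
  (* The first coordinates are spelled with [twist s (w ^+ 2)], so that
     additivity gives an equation in [x * y' - x' * y] alone. *)
  rewrite /twist !exprMn.
  transitivity ((x + w * x ^+ (q ^ s)) * (y' + w * y' ^+ (q ^ s))); first by ring.
  by rewrite uv; ring.
move/eqP; rewrite -subr_eq0 -linearB => /eqP /(twist_eq0 K s _ _ q_odd wN) z0 sumE.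
have {z0} /eqP : x * y' - x' * y = 0 by apply: z0; rewrite rpredB ?rpredM.
rewrite subr_eq0 => /eqP xy.
have xyQ : x ^+ (q ^ s) * y' ^+ (q ^ s) = x' ^+ (q ^ s) * y ^+ (q ^ s).
  by rewrite -!exprMn xy.
have scale (z z' : L) : (exists c : F, z' = c *: z) ->
    z' + w * z' ^+ (q ^ s) \in <[z + w * z ^+ (q ^ s)]>%VS.
  case=> c ->; rewrite -[X in X \in _]/(twist s w _) linearZ.
  by rewrite memvZ ?memv_line.
case: (sum_prod_eq _ _ _ _ _ sumE).
- transitivity (x * y' * (x ^+ (q ^ s) * y' ^+ (q ^ s))); first by ring.
  by rewrite xy xyQ; ring.
- move=> E; right; apply/scale/expr_card_ratio => //.
  apply: (mulIf (expf_neq0 (q ^ s) y0)).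
  transitivity (x ^+ (q ^ s) * (x' * y ^+ (q ^ s))); first by ring.
  by rewrite -E [RHS]mulrAC -xyQ; ring.
- move=> E; left; apply/scale/expr_card_ratio => //.
  apply: (mulIf (expf_neq0 (q ^ s) x'0)).
  transitivity (x ^+ (q ^ s) * (x' ^+ (q ^ s) * y)); first by ring.
  by rewrite -E [RHS]mulrAC [y ^+ _ * _]mulrC -xyQ; ring.
Qed.

End SpaceT.
End FrobeniusPowers.

(** * Weights of points *)

Section Points.

Variables (F : fieldType) (L : fieldExtType F) (k : nat).
Local Notation V := {ffun 'I_k -> L}.

Lemma ffun_neq0P (R : nmodType) (v : {ffun 'I_k -> R}) :
  reflect (exists j, v j != 0) (v != 0).
Proof.
apply: (iffP idP) => [v0|[j]]; last by apply: contraNneq => ->; rewrite ffunE.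
apply/existsP; apply: contraNT v0; rewrite negb_exists => /forallP v0.
by apply/eqP/ffunP=> j; rewrite ffunE; apply/eqP; rewrite -[_ == _]negbK v0.
Qed.

Lemma dim_ge2P (vT : vectType F) (U : {vspace vT}) :
  (2 <= \dim U)%N -> exists a b, [/\ a \in U, b \in U, a != 0 & b \notin <[a]>%VS].
Proof.
move=> U2; have U0 : U != 0%VS by rewrite -dimv_eq0 -lt0n ltnW.
have : ~~ (U <= <[vpick U]>)%VS.
  apply: contraL U2 => /dimvS; rewrite dim_vline -ltnNge => /leq_ltn_trans.
  by apply; case: (_ != _).
case/subvPn=> b bU bP; exists (vpick U), b; split=> //; first exact: memv_pick.
by rewrite vpick0.
Qed.

Lemma point_id (v : V) : v \in point v.
Proof. by apply/memv_point; exists 1; apply/ffunP=> j; rewrite ffunE mul1r. Qed.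

Lemma point_scale (a : L) (v : V) : a != 0 -> point [ffun j => a * v j] = point v.
Proof.
move=> a0; apply/vspaceP=> u; apply/memv_point/memv_point=> -[b ->].
  by exists (b * a); apply/ffunP=> j; rewrite !ffunE mulrA.
by exists (b / a); apply/ffunP=> j; rewrite !ffunE mulrA divfK.
Qed.

Lemma point_eq (u v : V) : u != 0 -> u \in point v -> point u = point v.
Proof.
move=> u0 /memv_point[a u_eq]; rewrite u_eq point_scale //.
apply: contraNneq u0 => a0; rewrite u_eq a0.
by apply/eqP/ffunP=> j; rewrite !ffunE mul0r.
Qed.

(** For [v != 0], multiplying [v] by scalars identifies [L] with [<v>_L]. *)
Lemma weight_point (U : {vspace V}) (v : V) :
  v != 0 -> weight U (point v) = \dim (linfun (scale_vec v) @^-1: U).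
Proof.
move=> /ffun_neq0P[j vj]; rewrite /weight /point capvC -lpreim_cap_limg.
rewrite -{1}(lpreimK (capvSr U (limg (linfun (scale_vec v))))) limg_dim_eq //.
apply/eqP; rewrite -subv0; apply/subvP=> a; rewrite memv_cap memv_ker lfunE.
case/andP=> _ /eqP/ffunP/(_ j); rewrite !ffunE memv0 => /eqP.
by rewrite mulf_eq0 (negPf vj) orbF.
Qed.

Lemma linear_set_weight (U P : {vspace V}) :
  linear_set U P <-> is_point P /\ (0 < weight U P)%N.
Proof.
split=> [[v [vU v0 ->]]|[[v [v0 ->]]]].
  split; first by exists v.
  rewrite lt0n dimv_eq0; apply: contraNneq v0 => U0.
  by rewrite -memv0 -U0 memv_cap point_id.
rewrite lt0n dimv_eq0 -vpick0 => u0; have := memv_pick (point v :&: U).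
rewrite memv_cap => /andP[uv uU]; exists (vpick (point v :&: U)).
by rewrite (point_eq _ _ u0 uv).
Qed.

(** [T^k] is the image of the space of all functions from [k] indices to [T],
    under the inclusion of [T] in [L]. *)
Lemma dim_power (T : {vspace L}) : \dim (power k T) = (k * \dim T)%N.
Proof.
pose incl (u : {ffun 'I_k -> subvs_of T}) : V := [ffun j => vsval (u j)].
have incl_lin : linear incl.
  by move=> c u v; apply/ffunP=> j; rewrite !ffunE linearP.
pose inclL := GRing.isLinear.Build F _ _ _ incl incl_lin.
pose f : {linear _ -> _} := HB.pack incl inclL.
have -> : power k T = limg (linfun f).
  apply/vspaceP=> v; apply/memv_power/memv_imgP=> [vT|[u _ ->] j].
    exists [ffun j => vsproj T (v j)]; first exact: memvf.
    by rewrite lfunE; apply/ffunP=> j; rewrite !ffunE /= vsprojK.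
  by rewrite lfunE /= ffunE subvsP.
rewrite limg_dim_eq; first by rewrite dimvf {1}/dim /= card_ord.
apply/eqP; rewrite capfv; apply/lker0P=> u u'; rewrite !lfunE => /ffunP uu'.
by apply/ffunP=> j; have := uu' j; rewrite !ffunE => /val_inj.
Qed.

Lemma rational_neq0 (a : {ffun 'I_k -> F}) :
  a != 0 -> [ffun j => (a j)%:A] != 0 :> V.
Proof.
case/ffun_neq0P=> j aj; apply/ffun_neq0P; exists j.
by rewrite ffunE scaler_eq0 oner_eq0 orbF.
Qed.

(** If [a] is a nonzero vector over [F] and [x] is in [L], the coordinates of
    [x a] are [F]-multiples of [x], at least one of them by a nonzero scalar; so
    [x a] is in [T^k] exactly when [x] is in [T]. *)
Lemma weight_rational (T : {vspace L}) (P : {vspace V}) :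
  is_rational_point P -> weight (power k T) P = \dim T.
Proof.
case=> a [a0 ->]; rewrite weight_point ?rational_neq0 //; congr (\dim _).
case/ffun_neq0P: a0 => j aj; apply/vspaceP=> x; rewrite -memv_preim lfunE.
apply/memv_power/idP=> [/(_ j)|xT l]; rewrite !ffunE mulr_algr; last exact: memvZ.
by move/(memvZ (a j)^-1); rewrite scalerA mulVf // scale1r.
Qed.

Lemma memv_line_mul (a b c : L) :
  c != 0 -> a * c \in <[b * c]>%VS -> a \in <[b]>%VS.
Proof.
move=> c0 /vlineP[l]; rewrite scalerAl => /(mulIf c0) ->.
by rewrite memvZ ?memv_line.
Qed.

(** If [a v] and [b v] are in [T^k] with [a], [b] independent over [F], the
    Sidon property for [(a v_j) (b v_l) = (a v_l) (b v_j)] makes every [v_l] an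
    [F]-multiple of a fixed nonzero [v_j]. *)
Lemma weight_sidon (T : {vspace L}) (P : {vspace V}) :
  sidon_space T -> is_point P -> (2 <= weight (power k T) P)%N ->
  is_rational_point P.
Proof.
move=> sT [v [v0 ->]]; rewrite weight_point // => /dim_ge2P[a [b []]].
rewrite -!memv_preim !lfunE => /memv_power aT /memv_power bT a0 abP.
case/ffun_neq0P: (v0) => j vj.
have ratio l : exists c : F, v l = c *: v j.
  have [->|vl] := eqVneq (v l) 0; first by exists 0; rewrite scale0r.
  have := sT _ _ _ _ (aT j) (aT l) (bT j) (bT l); rewrite !ffunE.
  case; rewrite ?mulf_neq0 //; first by ring.
    by move/(memv_line_mul _ _ _ vj); rewrite (negPf abP).
  by rewrite ![a * _]mulrC => /(memv_line_mul _ _ _ a0)/vlineP.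
have [c vE] := fin_all_exists ratio.
have v_eq : v = [ffun l => v j * [ffun l => ([ffun l => c l] l)%:A] l].
  by apply/ffunP=> l; rewrite !ffunE mulr_algr -vE.
exists [ffun l => c l]; split; last by rewrite {1}v_eq point_scale.
apply/ffun_neq0P; exists j; rewrite ffunE.
by apply: contraNneq vj => cj; rewrite vE cj scale0r.
Qed.

(** The witness is [(u : u' : ... : u')], with [u] and [u'] in [T] independent
    over [F]. *)
Lemma exists_nonrational (T : {vspace L}) :
  (2 <= \dim T)%N -> (1 < k)%N ->
  exists P : {vspace V}, linear_set (power k T) P /\ ~ is_rational_point P.
Proof.
case/dim_ge2P=> u [u' [uT u'T u0 uu']] k1.
pose v : V := [ffun j : 'I_k => if j == 0 :> nat then u else u'].
pose j0 := Ordinal (ltnW k1); pose j1 := Ordinal k1.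
exists (point v); split.
  exists v; split=> //; last by apply/ffun_neq0P; exists j0; rewrite ffunE.
  by apply/memv_power=> j; rewrite ffunE; case: ifP.
case=> a [a0 Pa]; have := point_id v; rewrite Pa => /memv_point[l vl].
have := congr1 (fun f : V => f j0) vl; have := congr1 (fun f : V => f j1) vl.
rewrite !ffunE /= !mulr_algr => u'E uE; case/negP: uu'.
have aj0 : a j0 != 0 by apply: contraNneq u0 => a_0; rewrite uE a_0 scale0r.
by apply/vlineP; exists (a j1 / a j0); rewrite uE u'E scalerA divfK.
Qed.

End Points.

(** * The number of points with coordinates in [F] *)

Lemma size_const_fibers (S : Type) (X : eqType) (f : S -> X) (m : nat)
    (s : seq S) :
    (forall x, x \in map f s -> count (fun a => f a == x) s = m) ->
  size s = (size (undup (map f s)) * m)%N.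
Proof.
move=> fib.
transitivity (\sum_(x <- undup (map f s)) count (fun a => f a == x) s)%N.
  have : all (preim f (mem (undup (map f s)))) s.
    by rewrite -all_map; apply/allP=> x; rewrite /= mem_undup.
  move: (undup_uniq (map f s)); move: (undup _) => r r_uniq {fib}.
  elim: s => [|a s IHs] /=; first by rewrite big1.
  case/andP=> ar /IHs ->; rewrite big_split /= -[LHS]add1n; congr (_ + _)%N.
  rewrite (bigD1_seq (f a)) //= eqxx big1 // => x /negPf.
  by rewrite eq_sym => ->.
rewrite big_seq (eq_bigr (fun=> m)) => [|x]; last by rewrite mem_undup => /fib.
by rewrite -big_seq big_const_seq count_predT iter_addn_0 mulnC.
Qed.

(** Two nonzero vectors over [F] define the same point exactly when they differ
    by a factor in [F^*]. *)
Lemma card_rational_points (F : finFieldType) (L : fieldExtType F) (k : nat) :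
  has_card (fun P : {vspace {ffun 'I_k -> L}} => is_rational_point P)
    ((#|F| ^ k - 1) %/ (#|F| - 1)).
Proof.
pose pt (a : {ffun 'I_k -> F}) : {vspace {ffun 'I_k -> L}} :=
  point [ffun j => (a j)%:A].
pose s := enum [pred a : {ffun 'I_k -> F} | a != 0].
have fib x : x \in map pt s -> count (fun a => pt a == x) s = (#|F| - 1)%N.
  case/mapP=> a; rewrite mem_enum inE => a0 ->.
  have <- : #|[set c : F | c != 0]| = (#|F| - 1)%N.
    by rewrite cardsE cardC1 subn1.
  have inj : injective (fun c : F => [ffun j => c * a j]).
    case/ffun_neq0P: a0 => j aj c d /ffunP/(_ j); rewrite !ffunE; exact: mulIf.
  rewrite -(card_imset _ inj) -size_filter cardE; apply/perm_size/uniq_perm.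
  - by rewrite filter_uniq ?enum_uniq.
  - exact: enum_uniq.
  move=> b; rewrite mem_filter !mem_enum inE; apply/andP/imsetP.
    case=> /eqP ba b0; have := point_id _ _ _ [ffun j => (b j)%:A : L].
    rewrite -/(pt b) ba => /memv_point[l bl].
    case/ffun_neq0P: a0 => j aj; have blE i : b i *: 1 = a i *: l.
      by move/ffunP/(_ i): bl; rewrite !ffunE mulr_algr.
    have b_eq : b = [ffun i => b j / a j * a i].
      apply/ffunP=> i; rewrite ffunE; apply: (fmorph_inj (in_alg L)) => /=.
      rewrite blE.
      have -> : l = (b j / a j)%:A.
        by rewrite mulrC -scalerA blE scalerA mulVf ?scale1r.
      by rewrite scalerA mulrC.
    exists (b j / a j) => //; rewrite inE; apply: contraNneq b0 => c0.
    by rewrite b_eq c0; apply/eqP/ffunP=> i; rewrite !ffunE mul0r.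
  case=> c; rewrite inE => c0 ->; split.
    have cL : c%:A != 0 :> L by rewrite scaler_eq0 oner_eq0 orbF.
    rewrite /pt -(point_scale _ _ _ _ [ffun j => (a j)%:A] cL).
    by apply/eqP; congr point; apply/ffunP=> j; rewrite !ffunE mulr_algl scalerA.
  case/ffun_neq0P: a0 => j aj; apply/ffun_neq0P; exists j.
  by rewrite ffunE mulf_neq0.
have size_s : size s = (#|F| ^ k - 1)%N.
  by rewrite -cardE cardC1 card_ffun card_ord subn1.
exists (undup (map pt s)); split; first exact: undup_uniq.
  rewrite -size_s (size_const_fibers _ _ _ _ _ fib) mulnK //.
  by rewrite subn_gt0 finNzRing_gt1.
move=> P; rewrite mem_undup; split=> [/mapP[a]|[a [a0 ->]]].
  by rewrite mem_enum => a0 ->; exists a.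
by apply/mapP; exists a; rewrite ?mem_enum.
Qed.

(** * Sidon spaces give regular fat linear sets *)

(** The weights of [T^k] separate the points of [PG(k-1, F)], of weight [dim T],
    from all others, of weight at most 1. *)
Lemma regular_fat_sidon (F : finFieldType) (L : fieldExtType F) (k : nat)
    (T : {vspace L}) :
    sidon_space T -> (2 <= \dim T)%N -> (1 < k)%N ->
  regular_fat ((#|F| ^ k - 1) %/ (#|F| - 1)) (\dim T) (power k T) /\
  (forall P, is_point P -> (weight (power k T) P = \dim T <-> is_rational_point P)).
Proof.
move=> sT T2 k1.
have weightP P : is_point P ->
    (weight (power k T) P = \dim T <-> is_rational_point P).
  move=> pP; split=> [wP|]; last exact: weight_rational.
  by apply: (weight_sidon _ _ _ T) => //; rewrite wP.
have weight1 P : linear_set (power k T) P -> ~ is_rational_point P ->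
    weight (power k T) P = 1%N.
  case/linear_set_weight=> pP P0 nP; apply/eqP; rewrite eqn_leq P0 andbT leqNgt.
  by apply/negP=> P2; case: nP; apply: (weight_sidon _ _ _ T).
split=> //; split.
- have [r [r_uniq r_size rP]] := card_rational_points F L k.
  exists r; split=> // P; rewrite rP; split=> [ratP|[/linear_set_weight[pP _]]].
    have PT := weight_rational _ _ _ T P ratP; split=> //.
    apply/linear_set_weight; rewrite PT (ltnW T2); split=> //.
    by case: ratP => a [a0 ->]; exists [ffun j => (a j)%:A]; rewrite rational_neq0.
  by move/(weightP P pP).
- move=> P lP wP; apply: weight1 => // ratP.
  by case: wP; apply: weight_rational.
- have [P [lP nP]] := exists_nonrational _ _ k T T2 k1.
  by exists P; split=> //; apply: weight1.
Qed.

Theorem theorem3p2 (q t s i k : nat)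
    (F : finFieldType) (L : fieldExtType F) (K : {subfield L})
    (w : L) (I : {vspace L})
    (hq : #|F| = q) (q_odd : odd q)
    (ht : (3 <= t)%N) (s_gt0 : (0 < s)%N) (hst : coprime s t)
    (dimL : \dim {:L} = (2 * t)%N) (dimK : \dim K = t)
    (wE : trace_q2t_qt t w = 0) (w_neq0 : w != 0)
    (wN : norm_qt_q t (w ^+ 2) != (-1) ^+ t)
    (IK : (I <= K)%VS) (dimI : \dim I = i) (hi : (2 <= i)%N)
    (hk : (1 < k)%N) :
  let Tk := power k (spaceT s w I) in
  [/\ regular_fat ((q ^ k - 1) %/ (q - 1)) i Tk,
      \dim Tk = (k * i)%N
    & forall P, is_point P -> (weight Tk P = i <-> is_rational_point P)].
Proof.
subst q t; rewrite -dimI in hi *; move=> Tk.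
have dimT : \dim (spaceT s w I) = \dim I by apply: (dim_spaceT _ _ K).
have sT : sidon_space (spaceT s w I) by apply: (sidon_spaceT _ _ K).
have [|fat ratP] := regular_fat_sidon F L k (spaceT s w I) sT _ hk.
  by rewrite dimT.
by rewrite -dimT; split=> //; apply: dim_power.
Qed.
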